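(* Let $m\ge3$ and let $M=M_m:[0,\lambda^{-1}]\to[0,1]$ be the Minkowski function defined in the context. (1) For every $\mathbf{s}\in\Sigma$ we have $M\circ B_{\mathbf{s}}=C_{\mathbf{s}}\circ M$ on $[0,\lambda^{-1}]$. (2) Let $F$ be any Farey-type map (determined by the leaves of a decorated $(m-1)$-ary tree). Then $T=M\circ F\circ M^{-1}$ is a piecewise-affine selfmap of $[0,1]$ all of whose pieces have coefficients in $\mathbb{Z}[1/(m-1)]$.
   Context: Fix an integer $m\ge3$ and let $\lambda=2\cos(\pi/m)$. $\mathrm{PSL}^\pm_2\mathbb{R}$ is the group of real $2\times2$ matrices of determinant $\pm1$ up to sign, acting on $\mathbb{R}\cup\{\infty\}$ by $x\mapsto(ax+b)/(cx+d)$; matrices denote their projective classes. Let $$L=\begin{pmatrix}1&0\\ \lambda&1\end{pmatrix},\ S=\begin{pmatrix}0&-1\\1&0\end{pmatrix},\ R=L^{-1}S=\begin{pmatrix}0&-1\\1&\lambda\end{pmatrix},$$ $A_j=SR^{-j}$ for $j=1,\dots,m-1$, $A_f=\begin{pmatrix}0&1\\1&0\end{pmatrix}$, and $B_s=LA_sL^{-1}$ for $s\in\{1,\dots,m-1,f\}$; each $B_s$ maps $[0,\lambda^{-1}]$ into itself. Let $C_j$ and $C_f$ be the affine maps of $\mathbb{R}$ given by $C_j(x)=\frac{x+j-1}{m-1}$ for $j=1,\dots,m-1$, and $C_f(x)=1-x$. $\Sigma$ is the monoid generated by $\{1,\dots,m-1,f\}$ modulo the relations $fj=(m-j)f$ (for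 $1\le j\le m-1$) and $f^2=1$. The maps $s\mapsto B_s$, $s\mapsto C_s$ extend to monoid homomorphisms $\mathbf{s}\mapsto B_{\mathbf{s}}$ and $\mathbf{s}\mapsto C_{\mathbf{s}}$ on $\Sigma$. Minkowski function: define $\pi_{\mathscr{B}}:\{1,\dots,m-1\}^{\mathbb{Z}_{\ge0}}\to[0,\lambda^{-1}]$ and $\pi_{\mathscr{C}}:\{1,\dots,m-1\}^{\mathbb{Z}_{\ge0}}\to[0,1]$ by $$\{\pi_{\mathscr{B}}(\omega)\}=\bigcap_{n\ge0}B_{\omega(0)}\cdots B_{\omega(n-1)}[0,\lambda^{-1}],\qquad \{\pi_{\mathscr{C}}(\omega)\}=\bigcap_{n\ge0}C_{\omega(0)}\cdots C_{\omega(n-1)}[0,1]$$ (the intersections are singletons). These maps are continuous, surjective, and have the same fibers, so $M_m=\pi_{\mathscr{C}}\circ\pi_{\mathscr{B}}^{-1}$ is a well-defined order-preserving homeomorphism from $[0,\lambda^{-1}]$ to $[0,1]$. Decorated trees and Farey-type maps: view $\{1,\dots,m-1\}^*$ as the set of nodes of the full $(m-1)$-ary tree (root the empty word, the children of $\mathbf{j}$ being $\mathbf{j}1,\dots,\mathbf{j}(m-1)$). A decorated tree is a finite subtree (containing the root, but not reduced to the root only) in which every node that is not a leaf has precisely $m-1$ children, and in which moreover some (possibly none) of the leaves $\mathbf{j}$ have been replaced by $\mathbf{j}f$. Let $\mathbf{s}_1,\dots,\mathbf{s}_q\in\Sigma$ be its leaves (after replacement) and $U=(0,\lambda^{-1})$.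 The sets $B_{\mathbf{s}_i}[U]$ are disjoint open intervals covering $U$ up to finitely many points. The Farey-type map determined by $\{\mathbf{s}_1,\dots,\mathbf{s}_q\}$ is the map $F$ defined by $B_{\mathbf{s}_i}^{-1}$ on $B_{\mathbf{s}_i}[U]$; it is extended to all of $[0,\lambda^{-1}]$ by setting $F(x)=B_{\mathbf{s}_i}^{-1}(x)$ with $i$ the minimum index such that $x\in B_{\mathbf{s}_i}[0,\lambda^{-1}]$. *)

(* Defs.v *)
From HB Require Import structures.
From mathcomp Require Import all_boot all_order all_algebra finmap.
From mathcomp Require Import generic_quotient ring lra.
From mathcomp Require Import all_classical all_reals all_analysis.

Set Implicit Arguments.
Unset Strict Implicit.
Unset Printing Implicit Defensive.

Import Order.TTheory GRing.Theory Num.Theory.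
Local Open Scope classical_set_scope.
Local Open Scope ring_scope.
Local Open Scope quotient_scope.

Section PSL.
Variable R : realType.

(* R together with one point at infinity: [Some t] is the real t, [None] is
   infinity. *)
Definition P1 : Type := one_point_compactification R.

HB.instance Definition _ := Choice.on P1.
HB.instance Definition _ := Pointed.on P1.

Definition mx2 (a b c d : R) : 'M[R]_2 :=
  \matrix_(i < 2, j < 2)
    if i == 0 then (if j == 0 then a else b) else (if j == 0 then c else d).

Lemma det_mx2 a b c d : \det (mx2 a b c d) = a * d - b * c.
Proof.
rewrite (expand_det_row _ 0) !big_ord_recl big_ord0 addr0 /cofactor !det_mx11.
by rewrite !mxE /= expr0 expr1 mul1r mulN1r mulrN.
Qed.

Lemma mx2_eta (A : 'M[R]_2) : A = mx2 (A 0 0) (A 0 1) (A 1 0) (A 1 1).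
Proof.
apply/matrixP => i j; rewrite mxE.
by case: i => [[|[|//]] hi]; case: j => [[|[|//]] hj] /=; congr (A _ _);
  apply/val_inj.
Qed.

Lemma mul_mx2 a b c d a' b' c' d' :
  mx2 a b c d *m mx2 a' b' c' d' =
  mx2 (a * a' + b * c') (a * b' + b * d') (c * a' + d * c') (c * b' + d * d').
Proof.
apply/matrixP => i j; rewrite !mxE !big_ord_recl big_ord0 addr0 !mxE /=.
by case: i => [[|[|//]] hi]; case: j => [[|[|//]] hj].
Qed.

Definition det_pm1 (A : 'M[R]_2) : bool := (\det A == 1) || (\det A == -1).

Definition SL2pm : Type := {A : 'M[R]_2 | det_pm1 A}.
HB.instance Definition _ := [isSub of SL2pm for @sval _ _].
HB.instance Definition _ := [Choice of SL2pm by <:].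

Lemma det_pm1P (A : SL2pm) : det_pm1 (val A). Proof. exact: valP. Qed.

Lemma det_pm1_1 : det_pm1 1%:M. Proof. by rewrite /det_pm1 det1 eqxx. Qed.

Lemma det_pm1_M A B : det_pm1 A -> det_pm1 B -> det_pm1 (A *m B).
Proof.
rewrite /det_pm1 det_mulmx => /orP[]/eqP-> /orP[]/eqP->;
by rewrite ?mul1r ?mulr1 ?mulrN1 ?opprK eqxx ?orbT.
Qed.

Lemma det_pm1_V A : det_pm1 A -> det_pm1 (invmx A).
Proof.
by rewrite /det_pm1 det_inv => /orP[]/eqP->; rewrite ?invrN invr1 eqxx ?orbT.
Qed.

Lemma det_pm1_unit A : det_pm1 A -> A \in unitmx.
Proof.
by rewrite /det_pm1 unitmxE => /orP[]/eqP->; rewrite ?unitrN unitr1.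
Qed.

Definition SL2pm1 : SL2pm := Sub 1%:M det_pm1_1.
Definition SL2pmM (A B : SL2pm) : SL2pm :=
  Sub (val A *m val B) (det_pm1_M (det_pm1P A) (det_pm1P B)).
Definition SL2pmV (A : SL2pm) : SL2pm :=
  Sub (invmx (val A)) (det_pm1_V (det_pm1P A)).

Definition eq_sign (A B : SL2pm) : bool :=
  (val A == val B) || (val A == - val B).

Lemma eq_sign_refl : reflexive eq_sign.
Proof. by move=> A; rewrite /eq_sign eqxx. Qed.

Lemma eq_sign_sym : symmetric eq_sign.
Proof.
by move=> A B; rewrite /eq_sign eq_sym; congr (_ || _); rewrite eq_sym eqr_oppLR.
Qed.

Lemma eq_sign_trans : transitive eq_sign.
Proof.
move=> B A C; rewrite /eq_sign => /orP[]/eqP-> /orP[]/eqP->;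
by rewrite ?opprK eqxx ?orbT.
Qed.

Canonical eq_sign_equiv := EquivRel eq_sign eq_sign_refl eq_sign_sym eq_sign_trans.

Definition PSL2pm : Type := {eq_quot eq_sign}.
HB.instance Definition _ : EqQuotient _ eq_sign PSL2pm := EqQuotient.on PSL2pm.
HB.instance Definition _ := Choice.on PSL2pm.

Definition proj_class (A : SL2pm) : PSL2pm := \pi A.

Lemma proj_classP A B : reflect (proj_class A = proj_class B) (eq_sign A B).
Proof. exact: eqmodP. Qed.

Lemma proj_classK x : proj_class (repr x) = x.
Proof. exact: reprK. Qed.

Lemma repr_sign A :
  val (repr (proj_class A)) = val A \/ val (repr (proj_class A)) = - val A.
Proof.
have /proj_classP : proj_class (repr (proj_class A)) = proj_class A.
  exact: proj_classK.
by rewrite /eq_sign => /orP[]/eqP; [left|right].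
Qed.

Definition PSL1 : PSL2pm := proj_class SL2pm1.
Definition PSLM (x y : PSL2pm) : PSL2pm := proj_class (SL2pmM (repr x) (repr y)).
Definition PSLV (x : PSL2pm) : PSL2pm := proj_class (SL2pmV (repr x)).

Lemma PSLM_class A B :
  PSLM (proj_class A) (proj_class B) = proj_class (SL2pmM A B).
Proof.
apply/proj_classP; rewrite /eq_sign /=.
by case: (repr_sign A) => ->; case: (repr_sign B) => ->;
  rewrite ?mulNmx ?mulmxN ?opprK eqxx ?orbT.
Qed.

Lemma PSLV_class A : PSLV (proj_class A) = proj_class (SL2pmV A).
Proof.
apply/proj_classP; rewrite /eq_sign /=.
case: (repr_sign A) => ->; first by rewrite eqxx.
by rewrite -[invmx (- _)]/((- val A)^-1) invrN eqxx orbT.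
Qed.

Lemma PSLA : associative PSLM.
Proof.
move=> x y z; rewrite -(proj_classK x) -(proj_classK y) -(proj_classK z).
by rewrite !PSLM_class; congr proj_class; apply/val_inj; rewrite /= mulmxA.
Qed.

Lemma PSL1M : left_id PSL1 PSLM.
Proof.
move=> x; rewrite -(proj_classK x) PSLM_class; congr proj_class.
by apply/val_inj; rewrite /= mul1mx.
Qed.

Lemma PSLM1 : right_id PSL1 PSLM.
Proof.
move=> x; rewrite -(proj_classK x) PSLM_class; congr proj_class.
by apply/val_inj; rewrite /= mulmx1.
Qed.

Lemma PSLVM : left_inverse PSL1 PSLV PSLM.
Proof.
move=> x; rewrite -(proj_classK x) PSLV_class PSLM_class; congr proj_class.
by apply/val_inj; rewrite /= mulVmx // det_pm1_unit // det_pm1P.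
Qed.

Lemma PSLMV : right_inverse PSL1 PSLV PSLM.
Proof.
move=> x; rewrite -(proj_classK x) PSLV_class PSLM_class; congr proj_class.
by apply/val_inj; rewrite /= mulmxV // det_pm1_unit // det_pm1P.
Qed.

HB.instance Definition _ :=
  isGroup.Build PSL2pm PSLA PSL1M PSLM1 PSLVM PSLMV.

Lemma mul_class A B :
  (proj_class A * proj_class B)%g = proj_class (SL2pmM A B).
Proof. exact: PSLM_class. Qed.

Definition mobius (A : 'M[R]_2) (x : P1) : P1 :=
  if x is Some t then
    if A 1 0 * t + A 1 1 == 0 then None
    else Some ((A 0 0 * t + A 0 1) / (A 1 0 * t + A 1 1))
  else if A 1 0 == 0 then None else Some (A 0 0 / A 1 0).

Definition psl_act (g : PSL2pm) (x : P1) : P1 := mobius (val (repr g)) x.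

Lemma mobiusN A x : mobius (- A) x = mobius A x.
Proof.
case: x => [t|] /=; rewrite !mxE ?oppr_eq0; last by rewrite invrN mulrNN.
by rewrite !mulNr -!opprD oppr_eq0 invrN mulrNN.
Qed.

Lemma act_class A x : psl_act (proj_class A) x = mobius (val A) x.
Proof. by rewrite /psl_act; case: (repr_sign A) => ->; rewrite ?mobiusN. Qed.

Lemma act1 x : psl_act 1%g x = x.
Proof.
by rewrite act_class; case: x => [t|] /=;
  rewrite !mxE /= ?mul0r ?add0r ?mul1r ?addr0 ?oner_eq0 ?divr1 ?eqxx.
Qed.

Lemma mobiusM (A B : 'M[R]_2) x : det_pm1 A -> det_pm1 B ->
  mobius (A *m B) x = mobius A (mobius B x).
Proof.
move=> hA hB.
have nzd (D : 'M[R]_2) : det_pm1 D -> D 0 0 * D 1 1 - D 0 1 * D 1 0 != 0.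
  by rewrite -det_mx2 -mx2_eta => /orP[]/eqP->; rewrite ?oppr_eq0 oner_eq0.
move: (nzd _ hA) (nzd _ hB).
rewrite (mx2_eta A) (mx2_eta B) mul_mx2.
move: (A 0 0) (A 0 1) (A 1 0) (A 1 1) (B 0 0) (B 0 1) (B 1 0) (B 1 1).
move=> a b c d a' b' c' d'; rewrite /mobius !mxE /= => nA nB.
case: x => [t|] /=.
- have [e0|ne0] := eqVneq (c' * t + d') 0.
  + have nu : a' * t + b' != 0.
      apply: contraNneq nB => u0.
      have [c0|c0] := eqVneq c' 0.
        by move: e0; rewrite c0 mul0r add0r => ->; rewrite !mulr0 subrr.
      have -> : a' * d' - b' * c' = a' * (c' * t + d') - c' * (a' * t + b') by ring.
      by rewrite e0 u0 !mulr0 subrr.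
    have -> : (c * a' + d * c') * t + (c * b' + d * d') =
              c * (a' * t + b') + d * (c' * t + d') by ring.
    have -> : (a * a' + b * c') * t + (a * b' + b * d') =
              a * (a' * t + b') + b * (c' * t + d') by ring.
    rewrite e0 !mulr0 !addr0 mulf_eq0 (negbTE nu) orbF.
    by case: eqVneq => // c0; congr Some; field; rewrite c0 nu.
  + have -> : (c * a' + d * c') * t + (c * b' + d * d') =
       (c * ((a' * t + b') / (c' * t + d')) + d) * (c' * t + d') by field.
    have -> : (a * a' + b * c') * t + (a * b' + b * d') =
       (a * ((a' * t + b') / (c' * t + d')) + b) * (c' * t + d') by field.
    rewrite mulf_eq0 (negbTE ne0) orbF; case: eqVneq => // h.
    by congr Some; rewrite -mulf_div divff // mulr1.
- have [e0|ne0] := eqVneq c' 0.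
  + have nu : a' != 0.
      by apply: contraNneq nB => ->; rewrite e0 mul0r mulr0 subrr.
    rewrite e0 !mulr0 !addr0 mulf_eq0 (negbTE nu) orbF.
    by case: eqVneq => // c0; congr Some; field; rewrite c0 nu.
  + have -> : c * a' + d * c' = (c * (a' / c') + d) * c' by field.
    have -> : a * a' + b * c' = (a * (a' / c') + b) * c' by field.
    rewrite mulf_eq0 (negbTE ne0) orbF; case: eqVneq => // h.
    by congr Some; rewrite -mulf_div divff // mulr1.
Qed.

Lemma actM (g h : PSL2pm) x : psl_act (g * h)%g x = psl_act g (psl_act h x).
Proof.
rewrite -[g]proj_classK -[h]proj_classK.
rewrite mul_class !act_class /=.
by rewrite mobiusM // det_pm1P.
Qed.

End PSL.

Section Monoid.
Variable m : nat.

(* Generators: [Some j], with j : 'I_m.-1, is the letter j + 1 of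
   {1, ..., m - 1}, and [None] is the letter f.  Thus [Some (rev_ord j)] is
   the letter m - (j + 1). *)
Definition gen : Type := option 'I_m.-1.

Inductive sigma_cong : seq gen -> seq gen -> Prop :=
| sigma_refl u : sigma_cong u u
| sigma_sym u v : sigma_cong u v -> sigma_cong v u
| sigma_trans u v w : sigma_cong u v -> sigma_cong v w -> sigma_cong u w
| sigma_cat u u' v v' :
    sigma_cong u u' -> sigma_cong v v' -> sigma_cong (u ++ v) (u' ++ v')
| sigma_fj (j : 'I_m.-1) :
    sigma_cong [:: None; Some j] [:: Some (rev_ord j); None]
| sigma_ff : sigma_cong [:: None; None] [::].

Definition sigma_eq (u v : seq gen) : bool := `[< sigma_cong u v >].

Lemma sigma_eq_refl : reflexive sigma_eq.
Proof. by move=> u; apply/asboolP; exact: sigma_refl. Qed.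

Lemma sigma_eq_sym : symmetric sigma_eq.
Proof. by move=> u v; apply/asboolP/asboolP; exact: sigma_sym. Qed.

Lemma sigma_eq_trans : transitive sigma_eq.
Proof.
by move=> v u w /asboolP uv /asboolP vw; apply/asboolP; exact: sigma_trans vw.
Qed.

Canonical sigma_equiv :=
  EquivRel sigma_eq sigma_eq_refl sigma_eq_sym sigma_eq_trans.

Definition Sigma : Type := {eq_quot sigma_eq}.
HB.instance Definition _ : EqQuotient _ sigma_eq Sigma := EqQuotient.on Sigma.
HB.instance Definition _ := Choice.on Sigma.

Definition sigma_class (u : seq gen) : Sigma := \pi u.

Lemma sigma_classP u v : sigma_class u = sigma_class v <-> sigma_cong u v.
Proof. by split=> [/eqmodP/asboolP|h]; [|apply/eqmodP/asboolP]. Qed.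

Lemma sigma_classK x : sigma_class (repr x) = x.
Proof. exact: reprK. Qed.

Lemma sigma_cong_repr u : sigma_cong (repr (sigma_class u)) u.
Proof. by apply/sigma_classP; exact: sigma_classK. Qed.

Definition sigma1 : Sigma := sigma_class [::].
Definition sigmaM (x y : Sigma) : Sigma := sigma_class (repr x ++ repr y).

Lemma sigmaM_class u v :
  sigmaM (sigma_class u) (sigma_class v) = sigma_class (u ++ v).
Proof. by apply/sigma_classP/sigma_cat; exact: sigma_cong_repr. Qed.

Lemma sigmaA : associative sigmaM.
Proof.
move=> x y z; rewrite -(sigma_classK x) -(sigma_classK y) -(sigma_classK z).
by rewrite !sigmaM_class catA.
Qed.

Lemma sigma1M : left_id sigma1 sigmaM.
Proof. by move=> x; rewrite -(sigma_classK x) sigmaM_class. Qed.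

Lemma sigmaM1 : right_id sigma1 sigmaM.
Proof. by move=> x; rewrite -(sigma_classK x) sigmaM_class cats0. Qed.

HB.instance Definition _ := isMonoid.Build Sigma sigmaA sigma1M sigmaM1.

Definition node : Type := seq 'I_m.-1.

Definition of_node (w : node) : Sigma := sigma_class (map Some w).
Definition sigma_f : Sigma := sigma_class [:: None].

End Monoid.

Section Maps.
Variables (R : realType) (m : nat).

Definition lambda : R := 2 * cos (pi / m%:R).

Lemma det_L : det_pm1 (mx2 1 0 lambda 1).
Proof. by rewrite /det_pm1 det_mx2 mulr1 mul0r subr0 eqxx. Qed.
Lemma det_S : det_pm1 (mx2 0 (-1) 1 0 : 'M[R]_2).
Proof. by rewrite /det_pm1 det_mx2 mulr0 mulr1 sub0r opprK eqxx. Qed.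
Lemma det_Af : det_pm1 (mx2 0 1 1 0 : 'M[R]_2).
Proof. by rewrite /det_pm1 det_mx2 mulr0 mulr1 sub0r eqxx orbT. Qed.

Definition pslL : PSL2pm R := proj_class (Sub _ det_L).
Definition pslS : PSL2pm R := proj_class (Sub _ det_S).
Definition pslR : PSL2pm R := (pslL^-1 * pslS)%g.

Definition A_ (g : gen m) : PSL2pm R :=
  if g is Some j then (pslS * pslR ^- j.+1)%g else proj_class (Sub _ det_Af).

Definition B_gen (g : gen m) : PSL2pm R := (pslL * A_ g * pslL^-1)%g.

Definition C_gen (g : gen m) (x : R) : R :=
  if g is Some j then (x + j.+1%:R - 1) / m.-1%:R else 1 - x.

Definition B_word (u : seq (gen m)) : PSL2pm R := (\prod_(g <- u) B_gen g)%g.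
Definition C_word (u : seq (gen m)) : R -> R :=
  foldr (fun g h => C_gen g \o h) id u.

Definition B_ (s : Sigma m) : PSL2pm R := B_word (repr s).
Definition C_ (s : Sigma m) : R -> R := C_word (repr s).

Lemma pslRE : forall h, pslR = proj_class (Sub (mx2 0 (-1) 1 lambda) h).
Proof.
move=> h; apply: (mulgI pslL); rewrite mulgA mulgV mul1g.
rewrite mul_class; congr proj_class; apply/val_inj.
rewrite /= mul_mx2; congr mx2; ring.
Qed.

(* In the angle theta = pi / m one has
   sin theta * R ^ n = [[ - sin ((n-1) theta), - sin (n theta) ],
                        [   sin (n theta),   sin ((n+1) theta) ]],
   hence R ^ m = -1. *)
Lemma pslR_m : (2 <= m)%N -> (pslR ^+ m = 1)%g.
Proof.
move=> m2; have hR : det_pm1 (mx2 0 (-1) 1 lambda).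
  by rewrite /det_pm1 det_mx2 mul0r mulr1 sub0r opprK eqxx.
set t : R := pi / m%:R.
have m0 : (0 : R) < m%:R by rewrite ltr0n; case: (m) m2.
have tm : m%:R * t = pi by rewrite /t mulrCA divff ?mulr1 // gt_eqF.
have st : sin t != 0.
  rewrite gt_eqF // sin_gt0_pi // /t divr_gt0 ?pi_gt0 //=.
  by rewrite ltr_pdivrMr // ltr_pMr ?pi_gt0 // ltr1n.
have pw n : exists h, (pslR ^+ n)%g = proj_class (Sub (mx2
    (- sin ((n%:R - 1) * t) / sin t) (- sin (n%:R * t) / sin t)
    (sin (n%:R * t) / sin t) (sin ((n%:R + 1) * t) / sin t)) h).
  elim: n => [|n [h IH]].
    have e : mx2 (- sin ((0%:R - 1) * t) / sin t) (- sin (0%:R * t) / sin t)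
       (sin (0%:R * t) / sin t) (sin ((0%:R + 1) * t) / sin t) = 1%:M.
      rewrite mul0r sin0 sub0r mulN1r sinN opprK add0r mul1r divff // oppr0 !mul0r.
      by rewrite [RHS]mx2_eta !mxE.
    have h : det_pm1 (mx2 (- sin ((0%:R - 1) * t) / sin t) (- sin (0%:R * t) / sin t)
       (sin (0%:R * t) / sin t) (sin ((0%:R + 1) * t) / sin t)).
      by rewrite e det_pm1_1.
    by exists h; rewrite expg0; congr proj_class; apply/val_inj => /=; rewrite e.
  have e : mx2 (- sin ((n%:R - 1) * t) / sin t) (- sin (n%:R * t) / sin t)
      (sin (n%:R * t) / sin t) (sin ((n%:R + 1) * t) / sin t) *m mx2 0 (-1) 1 lambda
    = mx2 (- sin ((n.+1%:R - 1) * t) / sin t) (- sin (n.+1%:R * t) / sin t)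
      (sin (n.+1%:R * t) / sin t) (sin ((n.+1%:R + 1) * t) / sin t).
    rewrite mul_mx2 /lambda -/t -[n.+1]addn1 natrD.
    have rec a : sin (a + t) = 2 * cos t * sin a - sin (a - t).
      by rewrite sinD sinB; ring.
    have e1 : (n%:R + 1 - 1) * t = n%:R * t by ring.
    have e2 : sin ((n%:R + 1 + 1) * t) =
        2 * cos t * sin ((n%:R + 1) * t) - sin (n%:R * t).
      have -> : (n%:R + 1 + 1) * t = (n%:R + 1) * t + t by ring.
      by rewrite rec; congr (_ - sin _); ring.
    have e3 : sin ((n%:R + 1) * t) =
        2 * cos t * sin (n%:R * t) - sin ((n%:R - 1) * t).
      have -> : (n%:R + 1) * t = n%:R * t + t by ring.
      by rewrite rec; congr (_ - sin _); ring.
    by rewrite e1 e2 {1}e3; congr mx2; rewrite ?e3; ring.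
  have h' := det_pm1_M h hR; move: (h'); rewrite e => h''.
  exists h''; rewrite expgSr IH (pslRE hR).
  rewrite mul_class; congr proj_class; apply/val_inj.
  by rewrite /= e.
have [h ->] := pw m; apply/proj_classP; rewrite /eq_sign /=; apply/orP; right.
have -> : (m%:R - 1) * t = pi - t by rewrite mulrBl tm mul1r.
have -> : (m%:R + 1) * t = pi + t by rewrite mulrDl tm mul1r.
rewrite tm sinpi sinB sinD sinpi cospi oppr0 !mul0r !mulN1r sub0r opprK add0r.
by rewrite mulNr divff // [X in _ == X]mx2_eta !mxE /= oppr0.
Qed.

Lemma B_word_cat u v : B_word (u ++ v) = (B_word u * B_word v)%g.
Proof. by rewrite /B_word big_cat. Qed.

Lemma B_gen_ff : (B_gen None * B_gen None = 1)%g.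
Proof.
rewrite /B_gen !mulgA mulgVK -(mulgA pslL) /=.
suff -> : (proj_class (Sub _ det_Af) * proj_class (Sub _ det_Af))%g = 1%g :> PSL2pm R.
  by rewrite mulg1 mulgV.
rewrite mul_class; congr proj_class; apply/val_inj.
by rewrite /= mul_mx2 [RHS]mx2_eta !mxE /=; congr mx2; ring.
Qed.

Lemma B_gen_fj (j : 'I_m.-1) :
  (B_gen None * B_gen (Some j) = B_gen (Some (rev_ord j)) * B_gen None)%g.
Proof.
have m2 : (2 <= m)%N by case: (m) j => [[]|[[]|]].
suff h : (A_ None * A_ (Some j) = A_ (Some (rev_ord j)) * A_ None)%g.
  have cj (l a b : PSL2pm R) : (l * a * l^-1 * (l * b * l^-1) = l * (a * b) * l^-1)%g.
    by rewrite !mulgA mulgVK.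
  by rewrite /B_gen !cj h.
rewrite /A_; set f := proj_class (Sub _ det_Af).
have fS : (f * pslS = pslS * f)%g.
  rewrite !mul_class.
  apply/proj_classP; rewrite /f /eq_sign /= !mul_mx2; apply/orP; right.
  by apply/eqP/matrixP => i k; rewrite !mxE;
    do ![case: (_ == 0)]; ring.
have hR : det_pm1 (mx2 0 (-1) 1 lambda).
  by rewrite /det_pm1 det_mx2 mul0r mulr1 sub0r opprK eqxx.
have fR : (pslR * f * pslR = f)%g.
  rewrite (pslRE hR) /f !mul_class.
  apply/proj_classP; rewrite /eq_sign /= !mul_mx2; apply/orP; left.
  by apply/eqP/matrixP => i k; rewrite !mxE; do ![case: (_ == 0)]; ring.
have fRn n : (pslR ^+ n * f * pslR ^+ n = f)%g.
  elim: n => [|n IH]; first by rewrite expg0 mul1g mulg1.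
  move: pslR fR IH => r fr IH; rewrite {1}expgSr expgS !mulgA.
  by rewrite -(mulgA _ r f) -(mulgA _ (r * f)%g r) fr.
have fV n : (f * pslR ^- n = pslR ^+ n * f)%g.
  by apply: (mulIg (pslR ^+ n)%g); rewrite mulgVK fRn.
rewrite mulgA fS -mulgA fV mulgA; congr (_ * _ * _)%g.
apply: (mulIg (pslR ^+ (rev_ord j).+1)%g); rewrite mulVg -expgnDr /=.
have -> : (j.+1 + (m.-1 - j.+1).+1 = m)%N.
  by rewrite addnS subnKC // prednK //; apply: ltnW.
exact: pslR_m.
Qed.

Lemma B_word_cong u v : sigma_cong u v -> B_word u = B_word v.
Proof.
elim=> {u v} // [u v w _ -> _ -> //|u u' v v' _ e _ e'|j|].
- by rewrite !B_word_cat e e'.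
- by rewrite /B_word !big_cons !big_nil !mulg1 B_gen_fj.
- by rewrite /B_word !big_cons !big_nil mulg1 B_gen_ff.
Qed.

Lemma B_class u : B_ (sigma_class u) = B_word u.
Proof. exact/B_word_cong/sigma_cong_repr. Qed.

Lemma B_monoid_morphism : monoid.monoid_morphism B_.
Proof.
split=> [|s t]; first by rewrite B_class /B_word big_nil.
rewrite -(sigma_classK s) -(sigma_classK t) -[(_ * _)%g in LHS]/(sigmaM _ _).
by rewrite sigmaM_class !B_class B_word_cat.
Qed.

HB.instance Definition _ :=
  isUMagmaMorphism.Build (Sigma m) (PSL2pm R) B_ B_monoid_morphism.

Lemma C_word_cat u v : C_word (u ++ v) = C_word u \o C_word v.
Proof. by elim: u => //= g u ->. Qed.

Lemma C_word_cong u v : sigma_cong u v -> C_word u = C_word v.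
Proof.
elim=> {u v} // [u v w _ -> _ -> //|u u' v v' _ e _ e'|j|].
- by rewrite !C_word_cat e e'.
- apply/funext => x /=.
  have m0 : (m.-1%:R : R) != 0.
    by rewrite pnatr_eq0 -lt0n; apply: leq_ltn_trans (ltn_ord j).
  have -> : ((m.-1 - j.+1).+1%:R : R) = m.-1%:R - j.+1%:R + 1.
    by rewrite -natr1 natrB.
  by field.
- by apply/funext => x /=; ring.
Qed.

Lemma C_class u : C_ (sigma_class u) = C_word u.
Proof. exact/C_word_cong/sigma_cong_repr. Qed.

Lemma C_1 : C_ 1%g = id.
Proof. by rewrite C_class. Qed.

Lemma C_M s t : C_ (s * t)%g = C_ s \o C_ t.
Proof.
rewrite -(sigma_classK s) -(sigma_classK t) -[(_ * _)%g in LHS]/(sigmaM _ _).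
by rewrite sigmaM_class !C_class C_word_cat.
Qed.

(* The interval [0, lambda^-1], as a subset of the projective line. *)
Definition I_B : set (P1 R) := Some @` `[0, lambda^-1].
Definition I_C : set R := `[0, 1].

(* [mkseq w n] is the word w(0) ... w(n-1); the intersections are singletons,
   and [get], [xget] return their point. *)
Definition pi_B (w : nat -> 'I_m.-1) : P1 R :=
  get (\bigcap_n (psl_act (B_ (of_node (mkseq w n))) @` I_B)).

Definition pi_C (w : nat -> 'I_m.-1) : R :=
  xget 0 (\bigcap_n (C_ (of_node (mkseq w n)) @` I_C)).

(* pi_C is constant on the fibers of pi_B, so that the image by pi_C of the
   fiber of pi_B over a point x of [0, lambda^-1] is a singleton. *)
Definition Minkowski (x : P1 R) : R := xget 0 (pi_C @` (pi_B @^-1` [set x])).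

Definition Minkowski_inv (y : R) : P1 R :=
  get (I_B `&` Minkowski @^-1` [set y]).

(* The value when x is in no B_s[0, lambda^-1] is irrelevant: these intervals
   cover [0, lambda^-1] when s enumerates the leaves of a decorated tree. *)
Definition farey (s : seq (Sigma m)) (x : P1 R) : P1 R :=
  let i := find (fun t => `[< (psl_act (B_ t) @` I_B) x >]) s in
  psl_act (B_ (nth 1%g s i))^-1%g x.

End Maps.

Arguments I_B : clear implicits.
Arguments I_C : clear implicits.
Arguments B_ R {m} s.
Arguments C_ R {m} s _.
Arguments Minkowski {R} m x.
Arguments Minkowski_inv {R} m y.
Arguments farey {R m} s x.

Section Trees.
Variable m : nat.
Local Open Scope fset_scope.

Record decorated_tree := DecoratedTree {
  nodes : {fset node m};
  flipped : pred (node m);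
  _ : [::] \in nodes;
  _ : nodes != [fset [::]];
  _ : forall (w : node m) j, rcons w j \in nodes -> w \in nodes;
  _ : forall (w : node m) j, rcons w j \in nodes ->
        forall k, rcons w k \in nodes
}.

Definition is_leaf (t : decorated_tree) (w : node m) : bool :=
  (w \in nodes t) && [forall j, rcons w j \notin nodes t].

Definition leaves (t : decorated_tree) : seq (Sigma m) :=
  [seq if flipped t w then (of_node w * sigma_f m)%g else of_node w
     | w <- nodes t & is_leaf t w].

End Trees.

Section PiecewiseAffine.
Variable R : realType.

(* The ring Z[a]: values at a of the polynomials with integer coefficients. *)
Definition Zadj (a : R) : set R :=
  [set (map_poly intr p).[a] | p in [set: {poly int}]].

(* D is the disjoint union of finitely many nondegenerate intervals, on each of
   which T is x |-> a x + b with a and b in K; nondegeneracy makes a and b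
   unique for each piece. *)
Definition piecewise_affine_over (K D : set R) (T : R -> R) : Prop :=
  exists (n : nat) (J : 'I_n -> interval R) (a b : 'I_n -> R),
    [/\ D = \bigcup_i [set` J i],
        trivIset setT (fun i => [set` J i]),
        forall i, exists x y, [/\ x < y, x \in J i & y \in J i],
        forall i, K (a i) /\ K (b i)
      & forall i x, x \in J i -> T x = a i * x + b i].

End PiecewiseAffine.

(* Main.v *)
Require Import Defs.
From mathcomp Require Import all_boot all_order all_algebra.
From mathcomp Require Import finmap ring lra zify.
From mathcomp Require Import all_classical all_reals all_analysis.

Set Implicit Arguments.
Unset Strict Implicit.
Unset Printing Implicit Defensive.

Import Order.TTheory GRing.Theory Num.Theory.
Local Open Scope classical_set_scope.
Local Open Scope ring_scope.

(** Both families (B_j) and (C_j) are "ladders": increasing branches carrying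
    an interval [0, c] onto consecutive subintervals, with cylinders of depth n
    of width at most 1 / (n + 1).  For B this holds because B_w acts by a
    nonnegative matrix of determinant 1, so that the width is 1 / (p q) with
    p, q >= 1 and p + q >= n + 2.  Whether two cylinders of the same depth
    touch depends on the words only, hence any two ladders have the same
    coincidences between infinite codes.  So M x = y iff x and y share a code;
    prepending a letter to a code gives (1) for the letters, and reversing all
    letters gives (1) for f, as f conjugates the j-th branch to the (m - j)-th
    one in both families.  For (2), the pieces of T are the intervals
    C_s[0, 1], s a leaf, minus the endpoints claimed by earlier leaves; on
    them T is the inverse of C_s, which has integer coefficients. *)

(** * Ladders *)

Definition word_map (T A : Type) (f : T -> A -> A) (w : seq T) : A -> A :=
  foldr (fun j h => f j \o h) id w.

Lemma word_map_cat (T A : Type) (f : T -> A -> A) u v x :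
  word_map f (u ++ v) x = word_map f u (word_map f v x).
Proof. by elim: u => //= j u ->. Qed.

Lemma mkseqD (T : Type) (w : nat -> T) n k :
  mkseq w (n + k) = mkseq w n ++ mkseq (w \o addn n) k.
Proof.
by rewrite /mkseq iotaD map_cat add0n -[n in iota n k]addn0 iotaDl -map_comp.
Qed.

(** [ladder_onto] stands in for continuity. The width bound is harmonic rather than geometric
    because the first branch of B, [t / (lambda t + 1)], is parabolic at 0. *)
Record ladder (R : realType) (K : nat) (c : R) (p : nat -> R)
    (f : 'I_K -> R -> R) : Prop := Ladder {
  ladder_gt0 : 0 < c;
  ladder_first : p 0%N = 0;
  ladder_last : p K = c;
  ladder_lo : forall j : 'I_K, f j 0 = p j;
  ladder_hi : forall j : 'I_K, f j c = p j.+1;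
  ladder_lt : forall (j : 'I_K) (x y : R), 0 <= x -> x < y -> y <= c -> f j x < f j y;
  ladder_onto : forall (j : 'I_K) (x : R), p j <= x <= p j.+1 ->
    exists2 y, 0 <= y <= c & f j y = x;
  ladder_width : forall w : seq 'I_K,
    word_map f w c - word_map f w 0 <= (size w).+1%:R^-1
}.

Definition coded (R : realType) (K : nat) (c : R) (f : 'I_K -> R -> R)
    (w : nat -> 'I_K) (x : R) : Prop :=
  forall n, exists2 y, 0 <= y <= c & word_map f (mkseq w n) y = x.


Section Ladder.
Variables (R : realType) (K : nat) (c : R) (p : nat -> R) (f : 'I_K -> R -> R).
Hypothesis lf : ladder c p f.

Lemma ladder_le j x y : 0 <= x -> x <= y -> y <= c -> f j x <= f j y.
Proof.
move=> x0; rewrite le_eqVlt => /predU1P[->//|xy yc].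
exact/ltW/(ladder_lt lf).
Qed.

Lemma ladder_step (j : 'I_K) : p j < p j.+1.
Proof.
rewrite -(ladder_lo lf) -(ladder_hi lf).
exact: (ladder_lt lf) (lexx _) (ladder_gt0 lf) (lexx _).
Qed.

Lemma ladder_nondecreasing i j : (i <= j)%N -> (j <= K)%N -> p i <= p j.
Proof.
move=> /subnKC <-; elim: (j - i)%N => [|n IH]; first by rewrite addn0.
rewrite addnS => h; apply: le_trans (IH (ltnW h)) _.
exact/ltW/(ladder_step (Ordinal h)).
Qed.

Lemma ladder_stable j x : 0 <= x <= c -> 0 <= f j x <= c.
Proof.
move=> /andP[x0 xc]; apply/andP; split.
  apply: le_trans (ladder_le j (lexx 0) x0 xc).
  by rewrite (ladder_lo lf) -(ladder_first lf) ladder_nondecreasing // ltnW.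
apply: le_trans (ladder_le j x0 xc (lexx c)) _.
by rewrite (ladder_hi lf) -(ladder_last lf) ladder_nondecreasing // ltn_ord.
Qed.

Lemma ladder_inj j x y : 0 <= x <= c -> 0 <= y <= c -> f j x = f j y -> x = y.
Proof.
move=> /andP[x0 xc] /andP[y0 yc] e; have [xy|yx|//] := ltgtP x y.
- by have := ladder_lt lf j x0 xy yc; rewrite e ltxx.
- by have := ladder_lt lf j y0 yx xc; rewrite e ltxx.
Qed.

Lemma ladder_cover x : 0 <= x <= c -> exists j, p j <= x <= p j.+1 /\ (j < K)%N.
Proof.
move=> /andP[x0]; rewrite -(ladder_last lf).
have : K != 0%N.
  apply/eqP => K0; have := ladder_gt0 lf.
  by rewrite -(ladder_last lf) K0 (ladder_first lf) ltxx.
elim: (K) => // n IH _ xn.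
have [xpn|nxp] := leP x (p n); last first.
  by exists n; rewrite ltnSn xn (ltW nxp).
have [n0|n0] := eqVneq n 0%N.
  by exists n; split; rewrite // xn andbT n0 (ladder_first lf).
by have [j [h jn]] := IH n0 xpn; exists j; split => //; apply: ltnW.
Qed.

Lemma ladder_onto_all x : 0 <= x <= c ->
  exists j y, 0 <= y <= c /\ f j y = x.
Proof.
move=> xc; have [j [h jK]] := ladder_cover xc.
by have [y yc <-] := ladder_onto lf (j := Ordinal jK) h;
  exists (Ordinal jK), y.
Qed.

Lemma word_stable w x : 0 <= x <= c -> 0 <= word_map f w x <= c.
Proof. by elim: w x => //= j w IH x xc; apply/ladder_stable/IH. Qed.

Lemma ladder_in0 : (0 : R) <= 0 <= c.
Proof. by rewrite lexx ltW // (ladder_gt0 lf). Qed.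

Lemma ladder_inc : 0 <= c <= c.
Proof. by rewrite lexx ltW // (ladder_gt0 lf). Qed.

Lemma word_lt w x y : 0 <= x -> x < y -> y <= c ->
  word_map f w x < word_map f w y.
Proof.
elim: w => //= j w IH x0 xy yc.
have /andP[wx _] : 0 <= word_map f w x <= c.
  by rewrite word_stable // x0 (le_trans (ltW xy)).
have /andP[_ wy] : 0 <= word_map f w y <= c.
  by rewrite word_stable // yc (le_trans x0 (ltW xy)).
by apply: (ladder_lt lf) => //; apply: IH.
Qed.

Lemma word_range w x : 0 <= x <= c ->
  word_map f w 0 <= word_map f w x <= word_map f w c.
Proof.
have le u v : 0 <= u -> u <= v -> v <= c -> word_map f w u <= word_map f w v.
  move=> u0; rewrite le_eqVlt => /predU1P[->//|uv vc]; exact/ltW/word_lt.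
by move=> /andP[x0 xc]; rewrite !le.
Qed.

Lemma word_inj w x y : 0 <= x <= c -> 0 <= y <= c ->
  word_map f w x = word_map f w y -> x = y.
Proof.
elim: w => //= j w IH xc yc e; apply: IH => //.
by apply: ladder_inj e; apply: word_stable.
Qed.

Lemma word_onto w x : word_map f w 0 <= x <= word_map f w c ->
  exists2 y, 0 <= y <= c & word_map f w y = x.
Proof.
elim: w x => [|j w IH] x /=; first by exists x.
move=> /andP[x0 xc].
have h0 := word_stable w ladder_in0; have hc := word_stable w ladder_inc.
have [z zc zx] : exists2 z, 0 <= z <= c & f j z = x.
  apply: (ladder_onto lf).
  rewrite -(ladder_lo lf) -(ladder_hi lf).
  move: h0 hc => /andP[a0 a1] /andP[b0 b1].
  rewrite (le_trans _ x0) ?ladder_le //=.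
  by rewrite (le_trans xc) ?ladder_le.
have [y yc yz] : exists2 y, 0 <= y <= c & word_map f w y = z.
  apply: IH; move: h0 hc zc => /andP[a0 a1] /andP[b0 b1] /andP[z0 zc].
  apply/andP; split; rewrite leNgt; apply/negP => h.
    by have := ladder_lt lf j z0 h a1; rewrite zx ltNge x0.
  by have := ladder_lt lf j b0 h zc; rewrite zx ltNge xc.
by exists y => //; rewrite yz.
Qed.

Lemma word_nested u v x : 0 <= x <= c ->
  word_map f u 0 <= word_map f (u ++ v) x <= word_map f u c.
Proof. by move=> xc; rewrite word_map_cat word_range // word_stable. Qed.

(** The cases are decided at the first letter where the words differ; if there is none, one word
    extends the other. *)
Lemma word_separate u v : u != v ->
  [\/ exists j u', u = v ++ j :: u', exists j v', v = u ++ j :: v',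
      word_map f u c <= word_map f v 0 | word_map f v c <= word_map f u 0].
Proof.
have lt_sep (j k : 'I_K) u' v' : (j < k)%N ->
    word_map f (j :: u') c <= word_map f (k :: v') 0.
  move=> jk /=; apply: (@le_trans _ _ (p j.+1)).
    rewrite -(ladder_hi lf).
    by have /andP[h0 h1] := word_stable u' ladder_inc; exact: ladder_le.
  apply: le_trans (ladder_nondecreasing jk (ltnW (ltn_ord k))) _.
  rewrite -(ladder_lo lf).
  by have /andP[h0 h1] := word_stable v' ladder_in0; exact: ladder_le.
elim: u v => [|j u IH] [|k v] //=; first by move=> _; constructor 2; exists k, v.
  by move=> _; constructor 1; exists j, u.
rewrite eqseq_cons; have [jk|kj|/val_inj <-] := ltngtP j k.
- by move=> _; constructor 3; apply: lt_sep.
- by move=> _; constructor 4; apply: lt_sep.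
have /andP[u0 uc] := word_stable u ladder_in0; have /andP[u0' uc'] := word_stable u ladder_inc.
have /andP[v0 vc] := word_stable v ladder_in0; have /andP[v0' vc'] := word_stable v ladder_inc.
rewrite eqxx /= => /IH[[i [u' ->]]|[i [v' ->]]|h|h].
- by constructor 1; exists i, u'.
- by constructor 2; exists i, v'.
- by constructor 3; apply: ladder_le.
- by constructor 4; apply: ladder_le.
Qed.

(** * Infinite codes of points *)

Lemma coded_in w x : coded c f w x -> 0 <= x <= c.
Proof. by case/(_ 0%N) => y yc <-. Qed.

(** The left endpoints of nested cylinders stay below all the right endpoints, so their supremum
    lies in every cylinder. *)
Lemma coded_exists_point w : exists x, coded c f w x.
Proof.
pose E := range (fun n => word_map f (mkseq w n) 0).
have ubE k : ubound E (word_map f (mkseq w k) c).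
  move=> _ [n _ <-].
  apply: (@le_trans _ _ (word_map f (mkseq w (n + k)) 0)).
    by rewrite mkseqD; case/andP: (word_nested (mkseq w n) (mkseq (w \o addn n) k) ladder_in0).
  by rewrite addnC mkseqD; case/andP: (word_nested (mkseq w k) (mkseq (w \o addn k) n) ladder_in0).
have E0 : E !=set0 by exists (word_map f (mkseq w 0) 0), 0%N.
exists (sup E) => n; apply: word_onto; rewrite ge_sup // andbT.
apply: ub_le_sup; first by exists (word_map f (mkseq w 0) c); exact: ubE.
by exists n.
Qed.

(** The code is the itinerary of [x] under chosen inverse branches. *)
Lemma coded_exists_code x : 0 <= x <= c -> exists w, coded c f w x.
Proof.
move=> xc; have [j0 _] := ladder_onto_all xc.
have /choice[h hP] (z : R) : exists jy : 'I_K * R,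
    0 <= z <= c -> 0 <= jy.2 <= c /\ f jy.1 jy.2 = z.
  have [zc|_] := boolP (0 <= z <= c); last by exists (j0, 0).
  by have [j [y yP]] := ladder_onto_all zc; exists (j, y).
pose orb n := iter n (fun z => (h z).2) x.
have orbP n : 0 <= orb n <= c by elim: n => //= n /hP[].
exists (fun n => (h (orb n)).1) => n; exists (orb n) => //.
elim: n => // n IH; rewrite mkseqS -cats1 word_map_cat /=.
by rewrite (hP _ (orbP n)).2.
Qed.

Lemma coded_cons w j x : coded c f w x ->
  coded c f (fun n => if n is k.+1 then w k else j) (f j x).
Proof.
move=> wx [|n]; first by exists (f j x) => //; apply/ladder_stable/(coded_in wx).
have [y yc <-] := wx n; exists y => //.
by rewrite -add1n mkseqD.
Qed.

(** Used with [phi] the flip and [r] the reversal [rev_ord] of the letters. *)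
Lemma coded_conj w x phi (r : 'I_K -> 'I_K) :
    (forall y, 0 <= y <= c -> 0 <= phi y <= c) ->
    (forall j y, 0 <= y <= c -> phi (f j y) = f (r j) (phi y)) ->
  coded c f w x -> coded c f (r \o w) (phi x).
Proof.
move=> phic phif wx n; have [y yc <-] := wx n; exists (phi y); first exact: phic.
rewrite /mkseq map_comp; elim: (map w _) => //= j u IH.
by rewrite IH phif // word_stable.
Qed.

End Ladder.

(** * Transfer of coincidences between two ladders *)

Section TwoLadders.
Variables (R : realType) (K : nat) (c d : R) (p q : nat -> R).
Variables (f g : 'I_K -> R -> R).
Hypotheses (lf : ladder c p f) (lg : ladder d q g).

(** A word whose cylinder reaches 0 uses only the first letter, and the first branch of any ladder
    fixes 0. *)
Lemma fixes_left u y : 0 <= y <= c -> word_map f u y = 0 -> word_map g u 0 = 0.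
Proof.
elim: u y => //= j u IH y yc /eqP.
have /andP[u0 u1] := word_stable lf u yc.
have p0 : 0 <= p j by rewrite -(ladder_first lf) (ladder_nondecreasing lf) // ltnW.
have := ladder_le lf j (lexx 0) u0 u1; rewrite (ladder_lo lf) => h /eqP e.
have pj0 : p j = 0 by apply/eqP; rewrite eq_le p0 -e h.
have j0 : j = 0%N :> nat.
  case: j pj0 {h e p0} => [[|j] jK] //= pj.
  have := ladder_step lf (Ordinal (ltnW jK)); rewrite /= pj.
  by rewrite ltNge -(ladder_first lf) (ladder_nondecreasing lf) // ltnW // ltnW.
have uy0 : word_map f u y = 0.
  apply: (ladder_inj lf (word_stable lf u yc) (ladder_in0 lf) (j := j)).
  by rewrite e (ladder_lo lf) pj0.
by rewrite (IH _ yc uy0) (ladder_lo lg) j0 (ladder_first lg).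
Qed.

Lemma fixes_right u y : 0 <= y <= c -> word_map f u y = c -> word_map g u d = d.
Proof.
elim: u y => //= j u IH y yc e.
have /andP[u0 u1] := word_stable lf u yc.
have pc : p j.+1 <= c by rewrite -(ladder_last lf) (ladder_nondecreasing lf) // ltn_ord.
have := ladder_le lf j u0 u1 (lexx c); rewrite (ladder_hi lf) => h.
have pjc : p j.+1 = c by apply/eqP; rewrite eq_le pc -e h.
have jK : j.+1 = K.
  apply/eqP; rewrite eqn_leq ltn_ord leqNgt; apply/negP => jK.
  have := ladder_step lf (Ordinal jK); rewrite /= pjc.
  by rewrite ltNge -(ladder_last lf) (ladder_nondecreasing lf) // jK.
have uyc : word_map f u y = c.
  apply: (ladder_inj lf (word_stable lf u yc) (ladder_inc lf) (j := j)).
  by rewrite e (ladder_hi lf) pjc.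
by rewrite (IH _ yc uyc) (ladder_hi lg) jK (ladder_last lg).
Qed.

(** Cylinders starting with [j < k] meet only if [k = j + 1], [u] reaches [c] and [v] reaches 0;
    [fixes_right] and [fixes_left] carry these conditions over to [g]. *)
Lemma touching_lt (j k : 'I_K) u v x y : (j < k)%N ->
    0 <= x <= c -> 0 <= y <= c ->
    word_map f (j :: u) x = word_map f (k :: v) y ->
  word_map g (j :: u) d = word_map g (k :: v) 0.
Proof.
move=> jk xc yc /= e.
have /andP[u0 u1] := word_stable lf u xc.
have /andP[v0 v1] := word_stable lf v yc.
have h1 := ladder_le lf j u0 u1 (lexx c).
have h2 := ladder_le lf k (lexx 0) v0 v1.
have h3 : p j.+1 <= p k by rewrite (ladder_nondecreasing lf) // ltnW.
move: h1 h2; rewrite (ladder_lo lf) (ladder_hi lf) => h1 h2.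
have e1 : f j (word_map f u x) = p j.+1.
  by apply/eqP; rewrite eq_le h1 (le_trans h3) // e.
have e2 : f k (word_map f v y) = p k.
  by apply/eqP; rewrite eq_le h2 -e (le_trans h1).
have kj : k = j.+1 :> nat.
  apply/eqP; rewrite eqn_leq jk andbT leqNgt; apply/negP => h.
  have jK : (j.+1 < K)%N by apply: leq_ltn_trans jk (ltn_ord k).
  have := ladder_step lf (Ordinal jK); rewrite /= -e1 e e2 ltNge.
  by rewrite (ladder_nondecreasing lf) // ltnW.
have e3 : word_map f u x = c.
  apply: (ladder_inj lf (word_stable lf u xc) (ladder_inc lf) (j := j)).
  by rewrite e1 (ladder_hi lf).
have e4 : word_map f v y = 0.
  apply: (ladder_inj lf (word_stable lf v yc) (ladder_in0 lf) (j := k)).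
  by rewrite e2 (ladder_lo lf).
rewrite (fixes_right xc e3) (fixes_left yc e4).
by rewrite (ladder_hi lg) (ladder_lo lg) kj.
Qed.

(* Whether two cylinders of the same depth meet is read off the words alone. *)
Lemma touching u v x y : size u = size v -> 0 <= x <= c -> 0 <= y <= c ->
    word_map f u x = word_map f v y ->
  exists x' y', [/\ 0 <= x' <= d, 0 <= y' <= d & word_map g u x' = word_map g v y'].
Proof.
have d0 := ladder_in0 lg; have dd := ladder_inc lg.
elim: u v => [|j u IH] [|k v] //=; first by exists 0, 0.
move=> [suv] xc yc e; have [jk|kj|jk] := ltngtP j k.
- by exists d, 0; split=> //; apply: (touching_lt jk xc yc).
- by exists 0, d; split=> //; symmetry; apply: (touching_lt kj yc xc).
- have jk' := val_inj jk; subst k.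
  have uv : word_map f u x = word_map f v y.
    by apply: (ladder_inj lf) e; apply: (word_stable lf).
  have [x' [y' [hx hy e']]] := IH _ suv xc yc uv.
  by exists x', y'; rewrite e'.
Qed.

(** With [g = f] this says that a code determines its point. From the ladder of B to that of C it
    makes M well defined; in the other direction it makes M injective. *)
Lemma coded_fibers w w' x y y' :
  coded c f w x -> coded c f w' x -> coded d g w y -> coded d g w' y' -> y = y'.
Proof.
move=> wx wx' wy wy'.
(* At depth [n] the two cylinders of [g] share a point [z], and [y] and [y'] are each within one
   width of it. *)
have close n : `|y - y'| <= 2 * n.+1%:R^-1.
  have [a ac ea] := wx n; have [a' ac' ea'] := wx' n.
  have [b bd eb] := wy n; have [b' bd' eb'] := wy' n.
  have [||z [z' [zd zd' ez]]] := @touching (mkseq w n) (mkseq w' n) a a' _ ac ac'.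
  - by rewrite !size_mkseq.
  - by rewrite ea ea'.
  have := ladder_width lg (mkseq w n); have := ladder_width lg (mkseq w' n).
  rewrite !size_mkseq -eb -eb'.
  have /andP[h1 h2] := word_range lg (mkseq w n) bd.
  have /andP[h3 h4] := word_range lg (mkseq w' n) bd'.
  have /andP[h5 h6] := word_range lg (mkseq w n) zd.
  have /andP[h7 h8] := word_range lg (mkseq w' n) zd'.
  rewrite ez in h5 h6.
  move: h1 h2 h3 h4 h5 h6 h7 h8; move: (n.+1%:R^-1) => e.
  move: (word_map g _ 0) (word_map g _ d) => a0 a1.
  by move=> *; rewrite ler_norml; apply/andP; split; lra.
apply/eqP; rewrite -subr_eq0 -normr_le0 leNgt; apply/negP => d0.
have d2 : 0 < `|y - y'| / 2 by rewrite divr_gt0.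
have [n] := ltr_add_invr d2; rewrite add0r => hn.
move: (close n) hn; move: (n.+1%:R^-1) `|y - y'| => a b; lra.
Qed.

End TwoLadders.

(** * The branches B_j and C_j *)

Section Branches.
Variables (R : realType) (m : nat).
Hypothesis hm : (3 <= m)%N.

Lemma C_word_sub (w : node m) (x y : R) :
  word_map (fun j => C_gen (Some j)) w x - word_map (fun j => C_gen (Some j)) w y
  = (x - y) / m.-1%:R ^+ size w.
Proof.
elim: w => [|j w IH] /=; first by rewrite expr0 divr1.
by rewrite -mulrBl exprSr invfM mulrA -IH; congr (_ / _); ring.
Qed.

Lemma C_ladder :
  ladder 1 (fun j => j%:R / m.-1%:R) (fun j : 'I_m.-1 => @C_gen R m (Some j)).
Proof.
have K0 : 0 < (m.-1%:R : R) by rewrite ltr0n; lia.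
have K1 : (m.-1%:R : R) != 0 by rewrite gt_eqF.
split=> //=.
- by rewrite mul0r.
- by rewrite divff.
- by move=> j; rewrite add0r -natr1 addrK.
- by move=> j; congr (_ / _); ring.
- by move=> j x y _ xy _; rewrite ltr_pM2r ?invr_gt0 // ltrD2r ltrD2r.
- move=> j x; rewrite ler_pdivrMr // ler_pdivlMr // -natr1 => h.
  by exists (x * m.-1%:R - j%:R); [lra | field].
(* For a word of length [n] the width is [(m - 1) ^ - n], and [n < (m - 1) ^ n] because
   [m - 1 >= 2]. *)
- move=> w; rewrite C_word_sub subr0 mul1r lef_pV2 ?posrE ?exprn_gt0 ?ltr0Sn //.
  by rewrite -natrX ler_nat ltn_expl //; lia.
Qed.

(** * Ratios of sines of the multiples of pi / m *)

Local Notation l := (@lambda R m).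
Local Notation theta := (pi / m%:R : R).

(** Ratio of a diagonal to the side of the regular m-gon, that is, the Chebyshev value U_(n-1)(cos
    theta). [A_chord] finds these numbers in the matrices A_j. *)
Definition chord (n : nat) : R := sin (n%:R * theta) / sin theta.

Let m0 : (0 : R) < m%:R. Proof. by rewrite ltr0n; lia. Qed.

Lemma sin_theta_gt0 n : (0 < n < m)%N -> 0 < sin (n%:R * theta).
Proof.
move=> /andP[n0 nm]; rewrite sin_gt0_pi // mulr_gt0 ?ltr0n ?divr_gt0 ?pi_gt0 //=.
by rewrite mulrCA gtr_pMr ?pi_gt0 // ltr_pdivrMr // mul1r ltr_nat.
Qed.

Let s0 : 0 < sin theta.
Proof. by have := @sin_theta_gt0 1; rewrite mul1r; apply; lia. Qed.

Lemma chord0 : chord 0 = 0.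
Proof. by rewrite /chord mul0r sin0 mul0r. Qed.

Lemma chord1 : chord 1 = 1.
Proof. by rewrite /chord mul1r divff // gt_eqF. Qed.

Lemma chord_m : chord m = 0.
Proof. by rewrite /chord mulrCA divff ?gt_eqF // mulr1 sinpi mul0r. Qed.

Lemma chord_rec n : chord n.+2 = l * chord n.+1 - chord n.
Proof.
rewrite /chord [l * _]mulrA -mulrBl /lambda; congr (_ / _).
have -> : n.+2%:R * theta = n.+1%:R * theta + theta by rewrite -[n.+2%:R]natr1; ring.
have -> : n%:R * theta = n.+1%:R * theta - theta by rewrite -[n.+1%:R]natr1; ring.
by rewrite sinD sinB; ring.
Qed.

(** An invariant of the recurrence, equal to 1 at [n = 0]; it is the determinant of the matrices in
    [A_chord]. *)
Lemma chord_det n : chord n.+1 ^+ 2 - chord n * chord n.+2 = 1.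
Proof.
elim: n => [|n <-]; first by rewrite chord0 chord1; ring.
by rewrite [chord n.+3]chord_rec [chord n.+2]chord_rec; ring.
Qed.

Lemma chord_ge0 n : (n <= m)%N -> 0 <= chord n.
Proof.
case: n => [|n]; first by rewrite chord0.
rewrite leq_eqVlt => /predU1P[->|nm]; first by rewrite chord_m.
by rewrite /chord divr_ge0 ?ltW // sin_theta_gt0.
Qed.

(* By [chord_det], chord n ^ 2 = 1 + chord (n-1) * chord (n+1) >= 1. *)
Lemma chord_ge1 n : (0 < n < m)%N -> 1 <= chord n.
Proof.
case: n => // n nm; have c0 := chord_ge0 (ltnW nm).
rewrite -(@ler_pXn2r _ 2%N) ?nnegrE // expr1n -(chord_det n) lerBlDr lerDl.
by rewrite mulr_ge0 ?chord_ge0 //; lia.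
Qed.

(** [lambda] is [chord 2], and [2 < m]. *)
Lemma lambda_ge1 : 1 <= l.
Proof.
have := chord_rec 0; rewrite chord0 chord1 mulr1 subr0 => <-.
by rewrite chord_ge1 //; lia.
Qed.

Let l0 : 0 < l. Proof. exact: lt_le_trans lambda_ge1. Qed.
Let ln0 : l != 0. Proof. by rewrite gt_eqF. Qed.

(* t and 1 - lambda t are homogeneous coordinates in which B_j acts by the
   nonnegative matrix A_j. *)
Definition B_num (j : nat) (t : R) := chord j.+1 * t + chord j * (1 - l * t).
Definition B_cof (j : nat) (t : R) := chord j.+2 * t + chord j.+1 * (1 - l * t).
(** The coordinates [(t, 1 - lambda t)] are normalised: lambda times the first plus the second is 1.
    Dividing the new coordinates by [B_den] restores this. *)
Definition B_den (j : nat) (t : R) := l * B_num j t + B_cof j t.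
Definition B_branch (j : 'I_m.-1) (t : R) := B_num j t / B_den j t.
(** A_f exchanges the two coordinates. *)
Definition B_flip (t : R) : R := (1 - l * t) / (l * (1 - l * t) + t).

Lemma coord_ge0 t : 0 <= t <= l^-1 -> 0 <= t /\ 0 <= 1 - l * t.
Proof. by rewrite -[l^-1]mul1r ler_pdivlMr // => /andP[]; split=> //; lra. Qed.

Lemma coord_gt0 t : 0 <= t <= l^-1 -> 0 < t + (1 - l * t).
Proof.
move=> /coord_ge0[]; rewrite le_eqVlt => /predU1P[<- _|]; first by lra.
by move=> *; apply: ltr_pwDl.
Qed.

Lemma chord_bounds (j : 'I_m.-1) :
  [/\ 0 <= chord j, 1 <= chord j.+1 & 0 <= chord j.+2].
Proof. by have := ltn_ord j; split; rewrite ?chord_ge0 ?chord_ge1 //; lia. Qed.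

Lemma B_coord_ge0 (j : 'I_m.-1) t : 0 <= t <= l^-1 ->
  [/\ 0 <= B_num j t, 0 <= B_cof j t & 0 < B_den j t].
Proof.
move=> tc; have [t0 t1] := coord_ge0 tc; have tt := coord_gt0 tc.
have [a0 a1 a2] := chord_bounds j.
have h1 : t + chord j * (1 - l * t) <= B_num j t by rewrite lerD2r ler_peMl.
have h2 : chord j.+2 * t + (1 - l * t) <= B_cof j t by rewrite lerD2l ler_peMl.
have h3 : 0 <= chord j * (1 - l * t) by rewrite mulr_ge0.
have h4 : 0 <= chord j.+2 * t by rewrite mulr_ge0.
have n0 : 0 <= B_num j t by apply: le_trans h1; lra.
split=> //; first by lra.
rewrite /B_den.
have : B_num j t <= l * B_num j t by rewrite ler_peMl // lambda_ge1.
lra.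
Qed.

Lemma B_branch_coord j t : 0 <= t <= l^-1 ->
  1 - l * B_branch j t = B_cof j t / B_den j t.
Proof.
move=> /(B_coord_ge0 j)[_ _ d0]; have d1 : B_den j t != 0 by rewrite gt_eqF.
by rewrite /B_branch; move: d1; rewrite /B_den => d1; field.
Qed.

(* The cross product of homogeneous coordinates is invariant under A_j. *)
Lemma B_cross j x y :
  B_num j y * B_den j x - B_num j x * B_den j y = y - x.
Proof.
by rewrite -[RHS]mulr1 -(chord_det j) /B_den /B_num /B_cof chord_rec; ring.
Qed.

Lemma B_branch_sub j x y : 0 <= x <= l^-1 -> 0 <= y <= l^-1 ->
  B_branch j y - B_branch j x = (y - x) / (B_den j x * B_den j y).
Proof.
move=> /(B_coord_ge0 j)[_ _ dx] /(B_coord_ge0 j)[_ _ dy].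
rewrite -(B_cross j x y) /B_branch; field.
by rewrite !gt_eqF.
Qed.

(* In homogeneous coordinates B_w acts by a matrix of determinant 1; [q] and
   [p] are its denominators at lambda^-1 and at 0, so that the width of
   B_w[0, lambda^-1] is 1 / (p q), while p + q grows by at least 1 with
   every letter. *)
Lemma B_word_shape (w : node m) : exists a b q p,
  [/\ a * p - b * q = 1, 1 <= q, 1 <= p, (size w).+2%:R <= q + p
    & forall t, 0 <= t <= l^-1 ->
        word_map B_branch w t = (a * t + b * (1 - l * t)) / (q * t + p * (1 - l * t))].
Proof.
have l1 := lambda_ge1.
elim/last_ind: w => [|w j [a [b [q [p [det q1 p1 qp IH]]]]]].
  (* The empty word has the matrix of L, which converts [(t, 1 - lambda t)] back to [(t, 1)]. *)
  exists 1, 0, l, 1; split=> //; first by ring.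
  - by rewrite -[2%:R]/(1 + 1) lerD2r.
  - move=> t _ /=; have -> : l * t + 1 * (1 - l * t) = 1 by ring.
    by rewrite divr1; ring.
have [a0 a1 a2] := chord_bounds j.
(* The sum equals [lambda * chord j.+1]; it bounds from below the growth of [q + p] at each
   letter. *)
have a3 : 1 <= chord j.+2 + chord j.
  by rewrite chord_rec subrK -[1]mulr1 ler_pM.
exists (a * chord j.+1 + b * chord j.+2), (a * chord j + b * chord j.+1).
exists (q * chord j.+1 + p * chord j.+2), (q * chord j + p * chord j.+1).
have h1 : q <= q * chord j.+1 by rewrite ler_peMr //; lra.
have h2 : p <= p * chord j.+1 by rewrite ler_peMr //; lra.
have h3 : chord j.+2 <= p * chord j.+2 by rewrite ler_peMl.
have h4 : chord j <= q * chord j by rewrite ler_peMl.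
split.
- by rewrite -[RHS]mulr1 -{1}det -(chord_det j); ring.
- by lra.
- by lra.
- by rewrite size_rcons -natr1; lra.
move=> t tc; have [n0 c0 d0] := B_coord_ge0 j tc.
have bc : 0 <= B_branch j t <= l^-1.
  rewrite /B_branch divr_ge0 ?(ltW d0) //= ler_pdivrMr // mulrC ler_pdivlMr //.
  by rewrite mulrC /B_den; lra.
rewrite -cats1 word_map_cat /= IH // B_branch_coord //.
have d1 : B_den j t != 0 by rewrite gt_eqF.
have e : q * B_num j t + p * B_cof j t =
    (q * chord j.+1 + p * chord j.+2) * t + (q * chord j + p * chord j.+1) * (1 - l * t).
  by rewrite /B_num /B_cof; ring.
have e2 : a * B_num j t + b * B_cof j t =
    (a * chord j.+1 + b * chord j.+2) * t + (a * chord j + b * chord j.+1) * (1 - l * t).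
  by rewrite /B_num /B_cof; ring.
rewrite -e -e2 /B_branch !mulrA -!mulrDl invfM invrK mulrACA mulVf // mulr1 //.
Qed.

Lemma B_ladder :
  ladder l^-1 (fun j => chord j / (l * chord j + chord j.+1)) B_branch.
Proof.
have i0 : (0 : R) <= 0 <= l^-1 by rewrite lexx invr_ge0 ltW.
have il : 0 <= l^-1 <= l^-1 by rewrite lexx invr_ge0 ltW.
split.
- by rewrite invr_gt0.
- by rewrite chord0 mul0r.
- have mE : m.-1.+1 = m by lia.
  rewrite mE chord_m addr0 invfM mulrCA divff ?mulr1 // gt_eqF //.
  by apply: lt_le_trans (chord_ge1 _); rewrite ?ltr01 //; lia.
- by move=> j; rewrite /B_branch /B_den /B_num /B_cof !mulr0 !add0r subr0 !mulr1.
- move=> j; rewrite /B_branch /B_den /B_num /B_cof mulfV // subrr !mulr0 !addr0.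
  have [_ a1 a2] := chord_bounds j.
  have d0 : l * chord j.+1 + chord j.+2 != 0.
    by rewrite gt_eqF // ltr_pwDl // mulr_gt0 // (lt_le_trans ltr01).
  by field; rewrite d0 ln0.
- move=> j x y x0 xy yc; have xc : 0 <= x <= l^-1 by rewrite x0 (le_trans (ltW xy)).
  have yc' : 0 <= y <= l^-1 by rewrite yc (le_trans x0 (ltW xy)).
  have [_ _ dx] := B_coord_ge0 j xc; have [_ _ dy] := B_coord_ge0 j yc'.
  by rewrite -subr_gt0 B_branch_sub // divr_gt0 ?subr_gt0 // mulr_gt0.
- move=> j x.
  have [a0 a1 a2] := chord_bounds j; have l1 := lambda_ge1.
  have la0 : 0 <= l * chord j by rewrite mulr_ge0 // ltW.
  have la1 : 0 < l * chord j.+1 by rewrite mulr_gt0 //; lra.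
  have lu : 0 < l * chord j + chord j.+1 by lra.
  have lv : 0 < l * chord j.+1 + chord j.+2 by lra.
  rewrite ler_pdivrMr // ler_pdivlMr //.
  move=> /andP[h1 h2].
  (* [X] and [Y] are the inverse of the matrix of A_j applied to [(x, 1 - lambda x)]; both are
     nonnegative exactly when [x] lies between the breakpoints. *)
  pose X := chord j.+1 * x - chord j * (1 - l * x).
  pose Y := chord j.+1 * (1 - l * x) - chord j.+2 * x.
  have X0 : 0 <= X by rewrite /X; lra.
  have Y0 : 0 <= Y by rewrite /Y; lra.
  have lX0 : X <= l * X by rewrite ler_peMl.
  have d := chord_det j.
  have XE : chord j.+1 * X + chord j * Y = x.
    transitivity (x * (chord j.+1 ^+ 2 - chord j * chord j.+2)).
      by rewrite /X /Y; ring.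
    by rewrite d mulr1.
  have YE : chord j.+2 * X + chord j.+1 * Y = 1 - l * x.
    transitivity ((1 - l * x) * (chord j.+1 ^+ 2 - chord j * chord j.+2)).
      by rewrite /X /Y; ring.
    by rewrite d mulr1.
  (* If [X] and [Y] both vanished, so would [x] and [1 - lambda x]. *)
  have D0 : 0 < l * X + Y.
    have Dge : 0 <= l * X + Y by lra.
    rewrite lt_neqAle Dge andbT; apply/eqP => D0.
    have X00 : X = 0 by lra.
    have Y00 : Y = 0 by lra.
    by move: XE YE; rewrite X00 Y00 !mulr0 addr0 => <-; lra.
  have D1 : l * X + Y != 0 by rewrite gt_eqF.
  exists (X / (l * X + Y)).
    rewrite divr_ge0 ?(ltW D0) //= ler_pdivrMr // mulrC ler_pdivlMr //.
    by rewrite mulrC; lra.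
  have n : B_num j (X / (l * X + Y)) = x / (l * X + Y).
    by rewrite -[in RHS]XE /B_num; field.
  have c : B_cof j (X / (l * X + Y)) = (1 - l * x) / (l * X + Y).
    by rewrite -YE /B_cof; field.
  have e : l * (x / (l * X + Y)) + (1 - l * x) / (l * X + Y) = (l * X + Y)^-1.
    by field.
  by rewrite /B_branch /B_den n c e invrK mulfVK.
- move=> w; have [a [b [q [p [det q1 p1 qp E]]]]] := B_word_shape w.
  rewrite !E // mulfV // subrr !mulr0 !addr0 !add0r subr0 !mulr1.
  have q0 : 0 < q := lt_le_trans ltr01 q1.
  have p0 : 0 < p := lt_le_trans ltr01 p1.
  have -> : a / l / (q / l) - b / p = (a * p - b * q) / (q * p).
    by field; rewrite ln0 !gt_eqF.
  rewrite det div1r lef_pV2 ?posrE ?mulr_gt0 ?ltr0Sn //.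
  (* For length [n], this gives [q p >= q + p - 1 >= n + 1]. *)
  have : 0 <= (q - 1) * (p - 1) by rewrite mulr_ge0 ?subr_ge0.
  by move: qp; rewrite -natr1; lra.
Qed.
End Branches.

(** * The action on the projective line *)

Lemma mobius_mx2 (R : realType) (a b c d t : R) : c * t + d != 0 ->
  mobius (mx2 a b c d) (Some t) = Some ((a * t + b) / (c * t + d)).
Proof. by move=> h; rewrite /mobius !mxE /= (negbTE h). Qed.

Section Action.
Variables (R : realType) (m : nat).
Hypothesis hm : (3 <= m)%N.

Local Notation l := (@lambda R m).
Local Notation chord := (@chord R m).

Lemma det_chord j :
  det_pm1 (mx2 (chord j.+1) (chord j) (chord j.+2) (chord j.+1)).
Proof.
by rewrite /det_pm1 det_mx2 -expr2 chord_det // eqxx.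
Qed.

Lemma det_R : det_pm1 (mx2 0 (-1) 1 l).
Proof. by rewrite /det_pm1 det_mx2 mul0r mulr1 sub0r opprK eqxx. Qed.

(** Right multiplication by R lowers the index of these matrices by one and turns the matrix of
    index 0 into S. *)
Lemma A_chord (j : 'I_m.-1) : A_ R (Some j) = proj_class (Sub _ (det_chord j)).
Proof.
suff h : forall n, (proj_class (Sub _ (det_chord n)) * pslR R m ^+ n.+1 = pslS R)%g.
  by rewrite /A_ -(h j) mulgK.
have [r rE] : exists r, r = pslR R m by exists (pslR R m).
have rec n : (proj_class (Sub _ (det_chord n.+1)) * r)%g =
    proj_class (Sub _ (det_chord n)).
  rewrite rE (pslRE det_R) mul_class; congr proj_class; apply/val_inj.
  by rewrite /= mul_mx2 [chord n.+3]chord_rec // [chord n.+2]chord_rec //;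
    congr mx2; ring.
have r0 : (proj_class (Sub _ (det_chord 0)) * r)%g = pslS R.
  rewrite rE (pslRE det_R) mul_class; congr proj_class; apply/val_inj.
  rewrite /= mul_mx2 chord_rec // chord1 // chord0 //.
  by congr mx2; ring.
rewrite -rE; elim=> [|n IH]; first by rewrite expg1.
by rewrite expgS mulgA rec IH.
Qed.

Lemma actB (j : 'I_m.-1) t : 0 <= t <= l^-1 ->
  psl_act (B_gen R (Some j)) (Some t) = Some (B_branch j t).
Proof.
move=> tc; have [_ _ d0] := B_coord_ge0 hm j tc.
(* The entries of [L A_j L^-1]. *)
pose a := chord j.+1 - l * chord j; pose b := chord j.
pose c := l * a + (chord j.+2 - l * chord j.+1); pose d := l * b + chord j.+1.
have hB : det_pm1 (mx2 a b c d).
  rewrite /det_pm1 det_mx2; apply/orP; left; apply/eqP.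
  by rewrite -(chord_det R hm j) /c /d /a /b; ring.
have -> : B_gen R (Some j) = proj_class (Sub _ hB).
  rewrite /B_gen A_chord; apply: (mulIg (pslL R m)); rewrite mulgVK.
  rewrite !mul_class; congr proj_class; apply/val_inj.
  by rewrite /= !mul_mx2 /c /d /a /b; congr mx2; ring.
have nE : a * t + b = B_num m j t by rewrite /a /b /B_num; ring.
have dE : c * t + d = B_den m j t by rewrite /c /d /a /b /B_den /B_num /B_cof; ring.
by rewrite act_class SubK mobius_mx2 ?nE ?dE // gt_eqF.
Qed.

Lemma flip_den_gt0 t : 0 <= t <= l^-1 -> 0 < l * (1 - l * t) + t.
Proof.
move=> tc; have [t0 t1] := coord_ge0 hm tc; have := coord_gt0 hm tc.
have : 1 - l * t <= l * (1 - l * t) by rewrite ler_peMl // lambda_ge1.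
lra.
Qed.

Lemma actB_flip t : 0 <= t <= l^-1 ->
  psl_act (@B_gen R m None) (Some t) = Some (B_flip m t) :> P1 R.
Proof.
move=> tc; have d0 := flip_den_gt0 tc.
have hB : det_pm1 (mx2 (- l) 1 (1 - l ^+ 2) l).
  by rewrite /det_pm1 det_mx2; apply/orP; right; apply/eqP; ring.
have -> : @B_gen R m None = proj_class (Sub _ hB).
  apply: (mulIg (pslL R m)); rewrite mulgVK !mul_class.
  congr proj_class; apply/val_inj.
  by rewrite /= !mul_mx2; congr mx2; ring.
have nE : - l * t + 1 = 1 - l * t by ring.
have dE : (1 - l ^+ 2) * t + l = l * (1 - l * t) + t by ring.
by rewrite act_class SubK mobius_mx2 ?nE ?dE // gt_eqF.
Qed.

Lemma B_flip_stable t : 0 <= t <= l^-1 -> 0 <= B_flip m t <= l^-1.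
Proof.
move=> tc; have d0 := flip_den_gt0 tc; have [t0 t1] := coord_ge0 hm tc.
have l0 : 0 < l by apply: lt_le_trans (lambda_ge1 R hm).
rewrite /B_flip divr_ge0 ?(ltW d0) //= ler_pdivrMr // [l^-1 * _]mulrC ler_pdivlMr //.
by lra.
Qed.

(** The relation [f j = (m - j) f] holds in the group already; stability of the interval lets it be
    read on the real formulas. *)
Lemma B_flip_branch (j : 'I_m.-1) t : 0 <= t <= l^-1 ->
  B_flip m (B_branch j t) = B_branch (rev_ord j) (B_flip m t).
Proof.
move=> tc; have bc := ladder_stable (B_ladder R hm) j tc.
have fc := B_flip_stable tc.
apply: Some_inj; rewrite -actB_flip // -actB // -actB // -actB_flip //.
by rewrite -!actM B_gen_fj.
Qed.

Lemma C_flip_branch (j : 'I_m.-1) (t : R) :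
  @C_gen R m None (C_gen (Some j) t) = C_gen (Some (rev_ord j)) (@C_gen R m None t).
Proof. exact: (congr1 (fun h => h t) (C_word_cong R (sigma_fj j))). Qed.

Lemma actB_word (w : node m) t : 0 <= t <= l^-1 ->
  psl_act (B_ R (of_node w)) (Some t) = Some (word_map (@B_branch R m) w t).
Proof.
move=> tc; rewrite /of_node B_class; elim: w => [|j w IH].
  by rewrite /B_word big_nil act1.
rewrite /B_word map_cons big_cons actM -/(B_word R _) IH actB //.
exact: (word_stable (B_ladder R hm) w tc).
Qed.

Lemma C_node (w : node m) :
  C_ R (of_node w) = word_map (fun j => C_gen (Some j)) w.
Proof. by rewrite /of_node C_class; elim: w => //= j w ->. Qed.

End Action.

(** * The Minkowski function *)

Section Conjugacy.
Variables (R : realType) (m : nat).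
Hypothesis hm : (3 <= m)%N.

Local Notation l := (@lambda R m).
Local Notation bB := (@B_branch R m).
Local Notation bC := (fun j : 'I_m.-1 => @C_gen R m (Some j)).
Local Notation codedB := (coded l^-1 bB).
Local Notation codedC := (coded 1 bC).
Let lB := B_ladder R hm.
Let lC := C_ladder R hm.

Lemma I_BP (x : P1 R) : I_B R m x <-> exists2 t, 0 <= t <= l^-1 & x = Some t.
Proof. by split=> [[t /= tc <-]|[t tc ->]]; exists t. Qed.

Lemma pi_B_coded w x : codedB w x -> pi_B R w = Some x.
Proof.
move=> wx; apply: xget_unique => [n _|y hy].
  have [t tc tx] := wx n; exists (Some t); first by apply/I_BP; exists t.
  by rewrite actB_word // tx.
(* At depth 0 the cylinder is [I_B] itself, so [y] is not the point at infinity. *)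
have [x0 /I_BP[t tc ->]] := hy 0%N I; rewrite actB_word //= => yt.
rewrite -yt; congr Some; apply: (coded_fibers lB lB wx wx _ wx) => n.
have [x1 /I_BP[t1 t1c ->]] := hy n I; rewrite actB_word // -yt => -[e].
by exists t1.
Qed.

Lemma pi_C_coded w y : codedC w y -> pi_C R w = y.
Proof.
move=> wy; apply: xget_unique => [n _|z hz].
  have [t tc tx] := wy n; exists t; first by rewrite /I_C /= in_itv.
  by rewrite C_node.
apply: (coded_fibers lC lC wy wy _ wy) => n.
have [t tc] := hz n I; rewrite /I_C /= in_itv /= in tc.
by rewrite C_node => e; exists t.
Qed.

(** Any other code [w'] of [x] yields the same [y], as coincidences for B pass to C. *)
Lemma Minkowski_coded w x y : codedB w x -> codedC w y ->
  Minkowski m (Some x : P1 R) = y.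
Proof.
move=> wx wy; apply: xget_unique; first by exists w; [exact: pi_B_coded|exact: pi_C_coded].
move=> _ [w' /= w'x <-].
have [x' w'x'] := coded_exists_point lB w'.
have [y' w'y'] := coded_exists_point lC w'.
rewrite (pi_C_coded w'y'); move: w'x; rewrite (pi_B_coded w'x') => -[e].
rewrite e in w'x'; exact: (coded_fibers lB lC w'x' wx).
Qed.

(** Together with [Minkowski_coded] this makes M the relation of sharing a code, the form used from
    here on. *)
Lemma Minkowski_codeP x : 0 <= x <= l^-1 ->
  exists w, codedB w x /\ codedC w (Minkowski m (Some x : P1 R)).
Proof.
move=> xc; have [w wx] := coded_exists_code lB xc.
have [y wy] := coded_exists_point lC w.
by exists w; rewrite (Minkowski_coded wx wy).
Qed.

Lemma Minkowski_in (x : P1 R) : I_B R m x -> 0 <= Minkowski m x <= 1.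
Proof. by move=> /I_BP[t tc ->]; have [w [_ /coded_in]] := Minkowski_codeP tc. Qed.

Lemma Minkowski_inj (x x' : P1 R) : I_B R m x -> I_B R m x' ->
  Minkowski m x = Minkowski m x' -> x = x'.
Proof.
move=> /I_BP[t tc ->] /I_BP[t' t'c ->] e; congr Some.
have [w [wt wy]] := Minkowski_codeP tc; have [w' [wt' wy']] := Minkowski_codeP t'c.
by rewrite -e in wy'; exact: (coded_fibers lC lB wy wy' wt wt').
Qed.

Lemma Minkowski_onto y : 0 <= y <= 1 ->
  exists2 x : P1 R, I_B R m x & Minkowski m x = y.
Proof.
move=> yc; have [w wy] := coded_exists_code lC yc.
have [x wx] := coded_exists_point lB w.
exists (Some x); last exact: Minkowski_coded wx wy.
by apply/I_BP; exists x => //; apply: coded_in wx.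
Qed.

Lemma C_flip_stable (y : R) : 0 <= y <= 1 -> 0 <= @C_gen R m None y <= 1.
Proof. by move=> yc /=; lra. Qed.

Lemma Minkowski_gen (g : gen m) (x : P1 R) : I_B R m x ->
  I_B R m (psl_act (B_gen R g) x) /\
  Minkowski m (psl_act (B_gen R g) x) = C_gen g (Minkowski m x).
Proof.
move=> /I_BP[t tc ->]; have [w [wt wy]] := Minkowski_codeP tc.
case: g => [j|].
  rewrite actB //; split.
    by apply/I_BP; exists (bB j t) => //; exact: (ladder_stable lB).
  by apply: Minkowski_coded (coded_cons lB j wt) _; apply: (coded_cons lC j wy).
rewrite actB_flip //; split.
  by apply/I_BP; exists (B_flip m t) => //; exact: B_flip_stable.
apply: (@Minkowski_coded (@rev_ord _ \o w)).
  apply: (coded_conj lB _ _ wt); [exact: B_flip_stable|exact: B_flip_branch].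
apply: (coded_conj lC _ _ wy); [exact: C_flip_stable|].
by move=> j y _; exact: C_flip_branch.
Qed.

(** [B_] and [C_] evaluate the same representative of [s], so an induction on that word suffices. *)
Lemma Minkowski_conj (s : Sigma m) (x : P1 R) : I_B R m x ->
  I_B R m (psl_act (B_ R s) x) /\
  Minkowski m (psl_act (B_ R s) x) = C_ R s (Minkowski m x).
Proof.
move=> hx; rewrite /B_ /C_; elim: (repr s) => [|g u [IH1 IH2]].
  by rewrite /B_word big_nil act1.
rewrite /B_word big_cons actM -/(B_word R _).
by have [h1 h2] := Minkowski_gen g IH1; split; rewrite // h2 IH2.
Qed.

(** The inverse of the branch [Some j] is [y -> (m - 1) y - j], and f is an involution, so no
    division occurs. *)
Lemma C_affine_inverse (s : Sigma m) :
  exists a b : int, forall z : R, a%:~R * C_ R s z + b%:~R = z.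
Proof.
rewrite /C_; elim: (repr s) => [|g u [a [b IH]]].
  by exists 1, 0 => z; rewrite mul1r addr0.
have K1 : (m.-1%:R : R) != 0 by rewrite pnatr_eq0; lia.
case: g => [j|] /=.
  exists (a * m.-1%:Z), (b - a * j%:Z) => z; rewrite -[RHS]IH -natr1.
  by rewrite !(rmorphM, rmorphB) /= -!pmulrn; field.
by exists (- a), (a + b) => z; rewrite -[RHS]IH !(rmorphN, rmorphD) /=; ring.
Qed.

Lemma Minkowski_invP y : 0 <= y <= 1 ->
  I_B R m (Minkowski_inv m y) /\ Minkowski m (Minkowski_inv m y) = y.
Proof.
by move=> /Minkowski_onto[x hx xy]; apply: (@xgetI _ _ (I_B R m `&` Minkowski m @^-1` [set y]) x).
Qed.

(** Transports to [[0, 1]] the membership test by which [farey] selects its branch. *)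
Lemma B_image_C (s : Sigma m) y : 0 <= y <= 1 ->
  (psl_act (B_ R s) @` I_B R m) (Minkowski_inv m y) <->
  (exists2 z, 0 <= z <= 1 & C_ R s z = y).
Proof.
move=> yc; have [hx xy] := Minkowski_invP yc; split.
  move=> [x' hx' e]; exists (Minkowski m x'); first exact: Minkowski_in.
  by rewrite -(Minkowski_conj s hx').2 e.
move=> [z zc e]; have [x' hx' xz] := Minkowski_onto zc; exists x' => //.
have [h1 h2] := Minkowski_conj s hx'.
by apply: Minkowski_inj; rewrite // h2 xz e.
Qed.

(** The searches on both sides of M stop at the same index, and M turns the inverse of the B-map
    found there into that of the C-map. *)
Lemma farey_conj (s : seq (Sigma m)) y : 0 <= y <= 1 ->
  let i := find (fun t => `[< exists2 z, 0 <= z <= 1 & C_ R t z = y >]) s in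
  (i < size s)%N ->
  let z := Minkowski m (farey s (Minkowski_inv m y)) in
  0 <= z <= 1 /\ C_ R (nth 1%g s i) z = y.
Proof.
move=> yc i hi; have [hx xy] := Minkowski_invP yc.
have iE : find (fun t => `[< (psl_act (B_ R t) @` I_B R m) (Minkowski_inv m y) >]) s = i.
  by apply: eq_find => t; apply/asbool_equiv_eq/B_image_C.
rewrite /farey iE.
have : has (fun t => `[< exists2 z, 0 <= z <= 1 & C_ R t z = y >]) s by rewrite has_find.
move=> /(nth_find 1%g)/asboolP/(B_image_C _ yc)[x' hx' e].
rewrite -/i in e; rewrite -e -actM mulVg act1; split; first exact: Minkowski_in.
by rewrite -(Minkowski_conj _ hx').2 e.
Qed.

End Conjugacy.

(** * Farey-type maps *)

Section FareyPieces.
Variables (R : realType) (m : nat) (t : decorated_tree m).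
Hypothesis hm : (3 <= m)%N.

Local Notation bC := (fun j : 'I_m.-1 => @C_gen R m (Some j)).
Local Notation lo w := (word_map bC w 0).
Local Notation up w := (word_map bC w 1).
Let lC := C_ladder R hm.

Definition leaf_label (w : node m) : Sigma m :=
  if flipped t w then (of_node w * sigma_f m)%g else of_node w.

(** A trailing f reverses [[0, 1]] before the word acts, hence leaves the image unchanged. *)
Lemma leaf_image (w : node m) (y : R) :
  (exists2 z, 0 <= z <= 1 & C_ R (leaf_label w) z = y) <-> lo w <= y <= up w.
Proof.
have Cw z : C_ R (leaf_label w) z = word_map bC w (if flipped t w then 1 - z else z).
  rewrite /leaf_label -C_node; case: ifP => // _.
  by rewrite C_M /sigma_f C_class.
split=> [[z zc <-]|/(word_onto lC)[z zc <-]].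
  by rewrite Cw; apply: (word_range lC); case: ifP => // _; lra.
exists (if flipped t w then 1 - z else z); first by case: ifP => // _; lra.
by rewrite Cw; case: (flipped t w) => //; congr (word_map _ _ _); ring.
Qed.

Lemma node_prefix (u v : node m) : u ++ v \in nodes t -> u \in nodes t.
Proof.
case: t => N fl /= _ _ pre _; elim/last_ind: v => [|v j IH]; first by rewrite cats0.
by rewrite -rcons_cat => /pre.
Qed.

Lemma root_node : [::] \in nodes t.
Proof. by case: t. Qed.

Lemma sibling_node (u : node m) j k :
  rcons u j \in nodes t -> rcons u k \in nodes t.
Proof. by case: t => N fl /= _ _ _ sib /sib. Qed.

Lemma leaf_no_extension (u v : node m) j :
  is_leaf t u -> u ++ j :: v \notin nodes t.
Proof.
move=> /andP[_ /forallP/(_ j)]; apply: contra.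
by rewrite -cat_rcons; exact: node_prefix.
Qed.

(** No leaf is a proper prefix of another, which rules out two cases of [word_separate]. *)
Lemma leaf_separate (u v : node m) : is_leaf t u -> is_leaf t v -> u != v ->
  up u <= lo v \/ up v <= lo u.
Proof.
move=> lu lv uv; have /andP[nu _] := lu; have /andP[nv _] := lv.
have [[j [u' e]]|[j [v' e]]|h|h] := word_separate lC uv; last 2 first.
- by left.
- by right.
- by have := leaf_no_extension u' j lv; rewrite -e nu.
- by have := leaf_no_extension v' j lu; rewrite -e nv.
Qed.

(** A code of [y] is followed down the finite tree; the last node before it leaves the tree has one
    child missing, hence all of them. *)
Lemma leaf_cover y : 0 <= y <= 1 -> exists2 w, is_leaf t w & lo w <= y <= up w.
Proof.
move=> /(coded_exists_code lC)[w wy].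
have [n] : exists n, mkseq w n \notin nodes t.
  exists (\max_(u <- nodes t) size u).+1; apply/negP => h.
  have := leq_bigmax_seq (P := xpredT) (F := size) _ h isT.
  by rewrite size_mkseq ltnn.
elim: n => [|n IH]; first by rewrite root_node.
have [nn|nn _] := boolP (mkseq w n \in nodes t); last exact: IH.
rewrite mkseqS => hn; exists (mkseq w n).
  rewrite /is_leaf nn; apply/forallP => j; apply: contra hn.
  exact: sibling_node.
by have [z zc <-] := wy n; apply: (word_range lC).
Qed.

Lemma lo_lt_up (w : node m) : lo w < up w.
Proof. exact: (word_lt lC). Qed.

Lemma Zadj_int (a : R) (k : int) : Zadj a k%:~R.
Proof. by exists k%:P => //; rewrite map_polyC hornerC. Qed.

Lemma farey_piecewise_affine (s : seq (Sigma m)) : perm_eq s (leaves t) ->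
  let T : R -> R := Minkowski m \o farey s \o Minkowski_inv m in
  {homo T : y / (0 <= y <= 1)} /\
  piecewise_affine_over (Zadj (m.-1%:R^-1)) `[0, 1] T.
Proof.
move=> sl T.
pose L := [seq w <- nodes t | is_leaf t w].
(* The permutation is lifted from labels to leaf words through positions, so that no labels have to
   be compared in the quotient [Sigma]. *)
have [Is IsP sE] : exists2 Is, perm_eq Is (iota 0 (size (map leaf_label L)))
    & s = map (nth (leaf_label [::]) (map leaf_label L)) Is.
  exact/perm_iotaP.
pose W := map (nth [::] L) Is.
have WL : perm_eq W L.
  by apply/(perm_iotaP [::]); exists Is => //; rewrite size_map in IsP.
have sW : s = map leaf_label W.
  rewrite sE -map_comp; apply/eq_in_map => i; rewrite (perm_mem IsP) mem_iota => h.
  by rewrite /= (nth_map [::]) // -(size_map leaf_label).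
have WP w : (w \in W) = is_leaf t w.
  by rewrite (perm_mem WL) mem_filter /is_leaf; case: (w \in nodes t); rewrite ?andbT ?andbF.
have uW : uniq W by rewrite (perm_uniq WL) filter_uniq // fset_uniq.
pose P y w := lo w <= y <= up w.
have findE y : find (fun t0 => `[< exists2 z, 0 <= z <= 1 & C_ R t0 z = y >]) s =
    find (P y) W.
  by rewrite sW find_map; apply: eq_find => w; apply/asboolP/idP => /leaf_image.
have hasP y : 0 <= y <= 1 -> has (P y) W.
  by move=> /leaf_cover[w wl wy]; apply/hasP; exists w; rewrite ?WP.
have TP y : 0 <= y <= 1 -> 0 <= T y <= 1 /\
    C_ R (nth 1%g s (find (P y) W)) (T y) = y.
  move=> yc; have := @farey_conj R m hm s y yc; rewrite findE; apply.
  by rewrite sW size_map -has_find hasP.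
split; first by move=> y /TP[].
pose w_ (i : 'I_(size W)) := nth [::] W i.
have leaf_w i : is_leaf t (w_ i) by rewrite -WP mem_nth.
pose hit (i : 'I_(size W)) y := has (P y) (take i W).
(* An endpoint is dropped if an earlier leaf claims it. [BSide true] is closed as a left bound and
   open as a right bound, whence the single negation. *)
pose J i := Interval (BSide (~~ hit i (lo (w_ i))) (lo (w_ i)))
                     (BSide (hit i (up (w_ i))) (up (w_ i))).
(* By [leaf_separate], earlier leaves can claim endpoints only. *)
have interior i y : lo (w_ i) < y < up (w_ i) -> ~~ hit i y.
  move=> /andP[y0 y1]; apply/hasPn => w wi; apply/negP => /andP[y2 y3].
  have wl : is_leaf t w by rewrite -WP; apply: mem_take wi.
  have wne : w != w_ i.
    apply: contraTneq wi => ->; rewrite /w_ in_take ?mem_nth // index_uniq //.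
    by rewrite ltnn.
  have [h|h] := leaf_separate wl (leaf_w i) wne.
    by have := le_lt_trans (le_trans y3 h) y0; rewrite ltxx.
  by have := lt_le_trans y1 (le_trans h y2); rewrite ltxx.
(* Being the level sets of the search, the pieces are disjoint and cover [[0, 1]]. *)
have JP i y : (y \in J i) = (find (P y) W == i).
  have -> : (find (P y) W == i) = P y (w_ i) && ~~ hit i y.
    rewrite /hit has_take_leq ?(ltnW (ltn_ord i)) // -leqNgt.
    apply/eqP/andP => [fi|[Pi]].
      split; last by rewrite fi.
      by rewrite /w_ -fi; apply: nth_find; rewrite has_find fi ltn_ord.
    rewrite leq_eqVlt => /predU1P[->//|/(before_find [::])].
    by rewrite -/(w_ i) Pi.
  rewrite /P in_itv /= /Order.lteif.
  have lu := lo_lt_up (w_ i).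
  have [y0|y0|y0] := ltgtP (lo (w_ i)) y.
  - have [y1|y1|y1] := ltgtP y (up (w_ i)).
    + by rewrite !if_same interior ?y0.
    + by rewrite !if_same andbF.
    + by rewrite if_same y1; case: (hit _ _).
  - by rewrite !if_same.
  - by rewrite -y0 lu (ltW lu) if_same; case: (hit _ _).
exists (size W), J.
have /choice[ab abP] (i : 'I_(size W)) : exists ab : int * int,
    forall z : R, ab.1%:~R * C_ R (nth 1%g s i) z + ab.2%:~R = z.
  by have [a [b h]] := C_affine_inverse R hm (nth 1%g s i); exists (a, b).
have Jc i y : y \in J i -> 0 <= y <= 1.
  rewrite JP => /eqP fi.
  have /andP[y0 y1] : P y (w_ i).
    by rewrite /w_ -fi; apply: nth_find; rewrite has_find fi ltn_ord.
  have /andP[w0 _] := word_stable lC (w_ i) (ladder_in0 lC).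
  have /andP[_ w1] := word_stable lC (w_ i) (ladder_inc lC).
  by rewrite (le_trans w0 y0) (le_trans y1 w1).
exists (fun i => (ab i).1%:~R), (fun i => (ab i).2%:~R); split.
- apply/seteqP; split=> [y /=|y [i _ /= /Jc]]; rewrite in_itv //= => yc.
  have := hasP y yc; rewrite has_find => fi.
  by exists (Ordinal fi) => //=; rewrite JP.
- move=> i k _ _ [y /= []]; rewrite !JP => /eqP -> /eqP h; exact: val_inj.
- move=> i; have lu := lo_lt_up (w_ i).
  have mid y : lo (w_ i) < y < up (w_ i) -> y \in J i.
    move=> /andP[y0 y1]; rewrite /J in_itv /= /Order.lteif.
    by rewrite y0 y1 !ltW // !if_same.
  (* Points at one and two thirds, since the endpoints may have been dropped. *)
  exists ((2 * lo (w_ i) + up (w_ i)) / 3), ((lo (w_ i) + 2 * up (w_ i)) / 3).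
  by move: lu mid; move: (lo _) (up _) => a b lu mid; split;
    [|apply: mid|apply: mid]; lra.
- by move=> i; split; exact: Zadj_int.
(* Here [C_s (T y) = y], and the affine inverse of [C_s] recovers [T y]. *)
- move=> i y yJ; have [_] := TP y (Jc _ _ yJ).
  move: yJ; rewrite JP => /eqP -> {2}<-.
  by rewrite abP.
Qed.
End FareyPieces.

(** All orderings [s] of the leaves are allowed, as the rule of the minimum index depends on the
    ordering. *)
Theorem theorem5p1 (R : realType) (m : nat) (hm : (3 <= m)%N) :
  (forall (s : Sigma m) (x : P1 R), I_B R m x ->
     Minkowski m (psl_act (B_ R s) x) = C_ R s (Minkowski m x))
  /\
  (forall (t : decorated_tree m) (s : seq (Sigma m)), perm_eq s (leaves t) ->
     let T : R -> R := Minkowski m \o farey s \o Minkowski_inv m in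
     {homo T : y / (0 <= y <= 1)} /\
     piecewise_affine_over (Zadj (m.-1%:R^-1)) `[0, 1] T).
Proof.
split=> [s x hx|t s]; first by have [_] := Minkowski_conj hm s hx.
exact: farey_piecewise_affine.
Qed.
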